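(* Let $p>2$ be a prime, let $(g,r)$ be a pair of nonnegative integers with $2g-2+r>0$, and let $\Gamma^+$ be a marked semi-graph whose underlying semi-graph $\Gamma$ is finite, connected, $3$-regular and of type $(g,r)$. (i) If there exists a strict $p$-branch numbering on $\Gamma^+$, then $g\le 1$. (ii) If $g=1$, then the inclusion $\mathrm{Br}^{\mathrm{st}}_{\Gamma^+,\vec e}\hookrightarrow \mathrm{Br}^{\mathrm{st}}_{\Gamma^+}$ is bijective, where $\vec e:=(-1,-1,\dots,-1)\in\mathbb F_p^{\times r}$ if $r>0$ (and $\vec e:=\emptyset$ if $r=0$), and $$\#\,\mathrm{Br}^{\mathrm{st}}_{\Gamma^+,\vec e}=\#\,\mathrm{Br}^{\mathrm{st}}_{\Gamma^+}=p-1 .$$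
   Context: A semi-graph $\Gamma$ consists of a set $V_\Gamma$ of vertices, a set $E_\Gamma$ of pairwise disjoint 2-element sets (edges; their elements are called branches, $B_\Gamma$ is the set of all branches, and $b^*$ denotes the other branch of the edge containing $b$), and a map $\zeta:B_\Gamma\to V_\Gamma\sqcup\{\mathrm{open}\}$. For $v\in V_\Gamma$ put $B_v:=\zeta^{-1}(v)$, and put $B^{\mathrm{open}}:=\zeta^{-1}(\mathrm{open})$. $\Gamma$ is finite if $V_\Gamma,E_\Gamma$ are finite; $3$-regular if $\#B_v=3$ for every vertex $v$. Connected means connected as a topological space: any two distinct vertices $u,v$ are joined by a path, i.e. a sequence of branches $b_1,\dots,b_l$ with $\zeta(b_1)=u$, $\zeta(b_l^* )=v$ and $\zeta(b_j^* )=\zeta(b_{j+1})\in V_\Gamma$ for $1\le j<l$, and no edge has both of its branches in $B^{\mathrm{open}}$. A finite connected 3-regular $\Gamma$ is of type $(g,r)$ if $r=\#B^{\mathrm{open}}$ and $g=1-\#V_\Gamma+\#E_\Gamma-\#B^{\mathrm{open}}$. (Loops and multiple edges are allowed.) A marked semi-graph $\Gamma^+$ is a finite semi-graph $\Gamma$ together with a bijection $\lambda:B^{\mathrm{open}}\to\{1,\dots,r\}$. A strict $p$-branch numbering on $\Gamma^+$ is a family $(m_b)_{b\in B_\Gamma}$ with $m_b\in\{1,\dots,p-1\}$, $m_{b^*}=p-m_b$ for all $b\in B_\Gamma$, and $\sum_{b\in B_v}m_b=p+1$ for every vertex $v$. The set of these is $\mathrm{Br}^{\mathrm{st}}_{\Gamma^+}$.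 For $\vec\varepsilon=(\varepsilon_i)_{i=1}^r\in\mathbb F_p^{\times r}$, $\mathrm{Br}^{\mathrm{st}}_{\Gamma^+,\vec\varepsilon}$ is the subset of those of exponent $\vec\varepsilon$, i.e. with $m_b \bmod p=\varepsilon_{\lambda(b)}$ for every $b\in B^{\mathrm{open}}$ (for $r=0$, $\vec\varepsilon=\emptyset$ imposes no condition). *)

(* Defs.v *)
From HB Require Import structures.
From mathcomp Require Import all_boot all_order all_algebra.

Set Implicit Arguments.
Unset Strict Implicit.
Unset Printing Implicit Defensive.

Import GRing.Theory.

(* Finite semi-graphs; [zeta b = None] means that [b] is sent to "open". The
   branch set is the union of the edges, so the edges partition [branch]. *)
Record semiGraph := SemiGraph {
  vertex : finType;
  branch : finType;
  edges : {set {set branch}};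
  edges_card2 : forall e, e \in edges -> #|e| = 2;
  edges_disjoint : trivIset edges;
  edges_cover : cover edges = [set: branch];
  zeta : branch -> option vertex
}.

Arguments edges : clear implicits.
Arguments zeta : clear implicits.

Definition star (G : semiGraph) (b : branch G) : branch G :=
  odflt b [pick c in pblock (edges G) b | c != b].

(* The default value in [star] is never used. *)
Lemma starP (G : semiGraph) (b : branch G) :
  star b != b /\ [set b; star b] \in edges G.
Proof.
have bC : b \in cover (edges G) by rewrite edges_cover inE.
have eE := pblock_mem bC; have be : b \in pblock (edges G) b by rewrite mem_pblock.
have c2 := edges_card2 eE; rewrite /star; case: pickP => [c /andP[ce cb]|none] /=.
  split=> //; suff -> : [set b; c] = pblock (edges G) b by [].
  by apply/eqP; rewrite eqEcard c2 cards2 eq_sym cb subUset !sub1set be ce.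
have := c2; rewrite (cardsD1 b) be; case: (set_0Vmem (pblock (edges G) b :\ b)).
  by move=> ->; rewrite cards0.
by case=> c; rewrite !inE => /andP[cb ce]; have := none c; rewrite ce cb.
Qed.

Definition Bv (G : semiGraph) (v : vertex G) : {set branch G} :=
  [set b | zeta G b == Some v].

Definition Bopen (G : semiGraph) : {set branch G} :=
  [set b | zeta G b == None].

Definition regular3 (G : semiGraph) : Prop := forall v : vertex G, #|Bv v| = 3.

Definition path_step (G : semiGraph) : rel (branch G) :=
  fun b c => (zeta G (star b) == zeta G c) && (zeta G c != None).

Definition joined (G : semiGraph) (u v : vertex G) : Prop :=
  exists (b : branch G) (s : seq (branch G)),
    [/\ zeta G b = Some u, path (@path_step G) b s
      & zeta G (star (last b s)) = Some v].

Definition connected (G : semiGraph) : Prop :=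
  (forall u v : vertex G, u != v -> joined u v) /\
  (forall e, e \in edges G -> ~~ (e \subset Bopen G)).

Definition of_type (G : semiGraph) (g r : nat) : Prop :=
  r = #|Bopen G| /\
  (g%:Z = 1 - #|vertex G|%:Z + #|edges G|%:Z - #|Bopen G|%:Z)%R.

(* The labels 1, ..., r are represented by 'I_r = {0, ..., r-1}. *)
Record markedSemiGraph (r : nat) := MarkedSemiGraph {
  underlying :> semiGraph;
  marking : {b : branch underlying | b \in Bopen underlying} -> 'I_r;
  marking_bij : bijective marking
}.

Definition strict_numbering (p : nat) (G : semiGraph)
    (m : {ffun branch G -> 'I_p}) : bool :=
  [&& [forall b, 0 < m b],
      [forall b, m (star b) == p - m b :> nat]
    & [forall v : vertex G, \sum_(b in Bv v) m b == p + 1]].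

Definition BrSt (p r : nat) (G : markedSemiGraph r) :
    {set {ffun branch G -> 'I_p}} :=
  [set m | strict_numbering m].

Definition BrSt_exp (p r : nat) (G : markedSemiGraph r)
    (eps : {ffun 'I_r -> {unit 'F_p}}) : {set {ffun branch G -> 'I_p}} :=
  [set m in BrSt p G |
    [forall b : {b : branch G | b \in Bopen G},
       (m (val b))%:R%R == val (eps (marking b))]].

Lemma BrSt_exp_sub (p r : nat) (G : markedSemiGraph r)
    (eps : {ffun 'I_r -> {unit 'F_p}}) : BrSt_exp G eps \subset BrSt p G.
Proof. by apply/subsetP=> m; rewrite inE => /andP[]. Qed.

Definition BrSt_incl (p r : nat) (G : markedSemiGraph r)
    (eps : {ffun 'I_r -> {unit 'F_p}})
    (m : {m | m \in BrSt_exp G eps}) : {m | m \in BrSt p G} :=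
  exist _ (val m) (subsetP (BrSt_exp_sub G eps) _ (valP m)).

Definition minus_ones (p r : nat) : {ffun 'I_r -> {unit 'F_p}} :=
  [ffun _ => FinRing.Unit (unitrN1 'F_p)].

(* Main.v *)
Require Import Defs.
From mathcomp Require Import all_boot all_order all_algebra zify.

(** Summing a strict numbering over all branches, once edge by edge and once
vertex by vertex, gives the sum of its values on the open branches (lemma
[sum_numbering]). Since a 3-regular semi-graph of type (g, r) has 2g - 2 + r
vertices and 3g - 3 + 2r edges, that sum is (p - 2)(g - 1) + (p - 1) r. As every
value is at most p - 1, the term (p - 2)(g - 1) cannot be positive, so g <= 1
([genus_le1]); and when g = 1 every open branch must carry the maximal value
p - 1, that is -1 modulo p ([open_value]).

It remains to count numberings when g = 1. Then the edges without open branch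
are as many as the vertices, so they form a connected graph with exactly one
cycle. Such a graph is the graph of a self-map of its vertices: each vertex v
can be given one outgoing branch [out v], leading to a vertex [hd v], so that
every such edge is used exactly once ([unicyclic_orientation]). To obtain it,
take a spanning tree, an edge c outside it, and root the tree at an end x of c:
every vertex other than x goes to its parent, and x goes along c. All orbits of
[hd] reach x, hence the cycle is the [hd]-orbit of x.

At a vertex v the three branches are [out v] and two others, each of which is
the far end of an open branch, with value 1, or of some [out u] with hd u = v,
with value p minus that of [out u]. Off the cycle no incoming edge comes from
the cycle, and the vertex condition forces the value p - 1 on [out v]
([numbering_off_cycle]); on the cycle exactly one incoming edge comes from the
cycle, and the condition says that the value on [out] is the same at u and at
hd u ([numbering_on_cycle]). So a numbering is determined by its value at
[out x], and conversely every value in 1, ..., p - 1 occurs ([card_BrSt]). *)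

Set Implicit Arguments.
Unset Strict Implicit.
Unset Printing Implicit Defensive.

Import GRing.Theory.

(** * Branches, edges and the sum formula *)

Lemma star_neq (G : semiGraph) (b : branch G) : star b != b.
Proof. by case: (starP b). Qed.

Lemma starK (G : semiGraph) : involutive (@star G).
Proof.
move=> b; have [sb eb] := starP b; have [ssb essb] := starP (star b).
have bC : star b \in [set b; star b] by rewrite !inE eqxx orbT.
have sbC : star b \in [set star b; star (star b)] by rewrite !inE eqxx.
have tI := edges_disjoint G.
have E : [set b; star b] = [set star b; star (star b)].
  by rewrite -(def_pblock tI eb bC) -(def_pblock tI essb sbC).
have : star (star b) \in [set b; star b] by rewrite E !inE eqxx orbT.
by rewrite !inE (negPf ssb) orbF => /eqP.
Qed.

Lemma card_branch (G : semiGraph) : #|branch G| = 2 * #|edges G|.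
Proof.
rewrite -cardsT -(edges_cover G) -(eqP (edges_disjoint G)).
rewrite (eq_bigr (fun=> 2)) ?sum_nat_const 1?mulnC // => e.
exact: edges_card2.
Qed.

Lemma sum_branch (G : semiGraph) (F : branch G -> nat) :
  \sum_b F b = \sum_v \sum_(b in Bv v) F b + \sum_(b in Bopen G) F b.
Proof.
rewrite (bigID (mem (Bopen G))) addnC; congr (_ + _).
under [RHS]eq_bigr do rewrite big_mkcond.
rewrite exchange_big big_mkcond; apply: eq_bigr => b _ /=.
rewrite inE; case E: (zeta G b) => [v|] /=.
  rewrite (bigD1 v) //= inE E eqxx big1 ?addn0 // => u uv.
  by rewrite inE E eq_sym (inj_eq Some_inj) (negPf uv).
by rewrite big1 // => v _; rewrite inE E.
Qed.

Lemma card_branch_regular (G : semiGraph) : regular3 G ->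
  2 * #|edges G| = 3 * #|vertex G| + #|Bopen G|.
Proof.
move=> reg; rewrite -card_branch -[LHS]sum1_card.
rewrite (sum_branch (fun=> 1)) sum1_card.
by under eq_bigr do rewrite sum1_card reg; rewrite sum_nat_const mulnC.
Qed.

Section Numbering.
Variables (p r : nat) (G : markedSemiGraph r).

Lemma BrStP (m : {ffun branch G -> 'I_p}) :
  reflect [/\ forall b, 0 < m b, forall b, m b + m (star b) = p
            & forall v : vertex G, \sum_(b in Bv v) m b = p + 1]
          (m \in BrSt p G).
Proof.
rewrite inE; apply: (iffP and3P) => [[/forallP m0 /forallP ms /forallP mv]|[m0 ms mv]].
  split=> // [b|v]; last exact/eqP.
  by rewrite (eqP (ms b)) subnKC // ltnW.
split; apply/forallP => // x; last exact/eqP.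
by apply/eqP; have := ms x; lia.
Qed.

(** Both sides are the sum of all values: the two branches of an edge add up to
p, the three branches at a vertex to p + 1. *)
Lemma sum_numbering (m : {ffun branch G -> 'I_p}) : m \in BrSt p G ->
  p * #|edges G| = #|vertex G| * (p + 1) + \sum_(b in Bopen G) m b.
Proof.
case/BrStP=> _ ms mv.
have := sum_branch (fun b => m b : nat).
under [X in _ = X + _]eq_bigr do rewrite mv.
rewrite sum_nat_const => <-.
apply/eqP; rewrite -(eqn_pmul2l (isT : 0 < 2)) mulnCA -card_branch mulnC.
rewrite -sum_nat_const mul2n -addnn [X in _ == _ + X](reindex_inj (inv_inj (@starK G))) /=.
by rewrite -big_split /=; apply/eqP/eq_bigr => b _; rewrite ms.
Qed.

Lemma numbering_le (m : {ffun branch G -> 'I_p}) b : m b <= p - 1.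
Proof. by have := ltn_ord (m b); lia. Qed.

(** The open branches would have to carry a total of (p - 2)(g - 1) + (p - 1) r,
but r values at most p - 1 cannot exceed (p - 1) r. *)
Lemma genus_le1 (g : nat) (m : {ffun branch G -> 'I_p}) :
  2 < p -> regular3 G -> of_type G g r -> m \in BrSt p G -> g <= 1.
Proof.
move=> p2 /card_branch_regular R [Er Eg] /sum_numbering S.
have : \sum_(b in Bopen G) m b <= #|Bopen G| * (p - 1).
  by rewrite -sum_nat_const; apply: leq_sum => b _; exact: numbering_le.
nia.
Qed.

(** In genus 1 the total (p - 1) r is the maximum, so each term is maximal. *)
Lemma open_value (m : {ffun branch G -> 'I_p}) :
  0 < p -> regular3 G -> of_type G 1 r -> m \in BrSt p G ->
  forall b, b \in Bopen G -> m b = p - 1 :> nat.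
Proof.
move=> p0 /card_branch_regular R [Er Eg] /sum_numbering S.
have := leqif_sum (fun b (_ : b \in Bopen G) => leqif_eq (numbering_le m b)).
case=> _; rewrite sum_nat_const.
have -> : \sum_(b in Bopen G) m b = #|Bopen G| * (p - 1) by nia.
rewrite eqxx => /esym/forallP H b bO.
by have := H b; rewrite bO => /eqP.
Qed.

End Numbering.

(** * Rooted spanning trees *)

(** Connectedness by the branches of [L], in the form that is easiest to use when
a subtree is extended one vertex at a time. *)
Definition cut_connected (G : semiGraph) (L : {set branch G}) : Prop :=
  forall A : {set vertex G}, A != set0 -> A != setT ->
    exists b u v, [/\ b \in L, zeta G b = Some u, zeta G (star b) = Some v,
      u \notin A & v \in A].

Definition closed_branches (G : semiGraph) : {set branch G} :=
  [set b | (zeta G b != None) && (zeta G (star b) != None)].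

(** A path from outside [A] to [v] in [A] has a first edge that enters [A]. *)
Lemma connected_cut (G : semiGraph) :
  connected G -> cut_connected (closed_branches G).
Proof.
move=> [conn _] A /set0Pn[v vA] AT.
have /subsetPn[u _ uA] : ~~ ([set: vertex G] \subset A) by rewrite subTset.
have [|b [s [zb pbs zs]]] := conn u v; first by apply: contraNneq uA => ->.
elim: s b u zb uA pbs zs => [|c s IHs] b u zb uA /=.
  by move=> _ zsb; exists b, u, v; rewrite inE zb zsb.
case/andP=> /andP[/eqP zsb zc]; case zc': (zeta G c) zc => [w|] // _.
have [wA _ _|wA] := boolP (w \in A); last exact: IHs zc' wA.
by exists b, u, w; rewrite inE zb zsb zc'.
Qed.

(** A tree on the vertex set [A] with root [x]: [par v] is the branch at [v] that
leads to the parent [hd v]. The absence of cycles is not put as a rank function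
but as the induction principle [rooted_reach], the form in which it is applied. *)
Record rooted (G : semiGraph) (x : vertex G) (A : {set vertex G})
    (par : vertex G -> branch G) (hd : vertex G -> vertex G) : Prop := Rooted {
  rooted_root : x \in A;
  rooted_par : forall v, v \in A :\ x -> zeta G (par v) = Some v;
  rooted_head : forall v, v \in A :\ x -> zeta G (star (par v)) = Some (hd v);
  rooted_headA : forall v, v \in A :\ x -> hd v \in A;
  rooted_star : {in A :\ x &, forall u v, star (par u) != par v};
  rooted_reach : forall Z : {set vertex G},
    {in A :\ x, forall v, v \in Z -> hd v \in Z} ->
    {in A, forall v, v \in Z -> x \in Z} }.

(** A tree that does not reach all vertices can be extended along a branch of [L]
which enters its vertex set. *)
Lemma spanning_tree (G : semiGraph) (L : {set branch G}) (d : branch G) (x : vertex G) :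
  cut_connected L ->
  exists par hd, rooted x [set: vertex G] par hd /\ {in [set~ x], forall v, par v \in L}.
Proof.
move=> cutL; have V0 : 0 < #|vertex G| by apply/card_gt0P; exists x.
suff [A [par [hd [cA RA LA]]]] : exists (A : {set vertex G}) par hd,
    [/\ #|A| = #|vertex G|.-1.+1, rooted x A par hd & {in A :\ x, forall v, par v \in L}].
  have AT : A = setT.
    by apply/eqP; rewrite eqEcard subsetT cA cardsT prednK ?leqnn.
  by exists par, hd; rewrite -AT; split=> // v vx; apply: LA; rewrite AT setTD.
have : #|vertex G|.-1 < #|vertex G| by rewrite prednK.
elim: _.-1 => [_|n IHn lt_n].
  exists [set x], (fun=> d), id; rewrite cards1.
  have A0 v : v \in [set x] :\ x = false by rewrite setDv inE.
  split=> //; last by move=> v; rewrite A0.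
  split=> [|v|v|v|u v|Z _ v]; rewrite ?A0 //; first exact: set11.
  by rewrite inE => /eqP->.
have [A [par [hd [cA RA LA]]]] := IHn (ltnW lt_n).
have [||b [w [v [bL zb zsb wA vA]]]] := cutL A.
- by apply/set0Pn; exists x; exact: rooted_root RA.
- by apply: contraTneq lt_n => AT; rewrite -cA AT cardsT ltnn.
have wx : w != x by apply: contraNneq wA => ->; exact: rooted_root RA.
have AE y : y \in (w |: A) :\ x -> (y == w) || (y != w) && (y \in A :\ x).
  by rewrite !inE; case: (y == w) (y == x) => [] [].
exists (w |: A), (fun y => if y == w then b else par y),
  (fun y => if y == w then v else hd y).
split; first by rewrite cardsU1 wA cA.
- case: RA => xA RP RH RHA RS RR; split.
  + by rewrite inE xA orbT.
  + by move=> y /AE/orP[/eqP->|/andP[/negPf-> yA]]; rewrite ?eqxx ?RP.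
  + by move=> y /AE/orP[/eqP->|/andP[/negPf-> yA]]; rewrite ?eqxx ?RH.
  + move=> y /AE/orP[/eqP->|/andP[/negPf-> yA]]; first by rewrite eqxx inE vA orbT.
    by rewrite inE RHA ?orbT.
  + (* The new branch starts outside [A]; the old ones have both ends in [A]. *)
    have bN y : y \in A :\ x -> (star b != par y) && (star (par y) != b).
      move=> yA; rewrite (inv_eq (@starK G) (par y)) [par y == _]eq_sym andbb.
      apply: contraNneq wA => E; have := RH _ yA.
      by rewrite -E starK zb => -[->]; exact: RHA.
    move=> y z /AE/orP[/eqP->|/andP[/negPf-> yA]] /AE/orP[/eqP->|/andP[/negPf-> zA]];
      rewrite ?eqxx ?star_neq ?RS //.
    * by case/andP: (bN _ zA).
    * by case/andP: (bN _ yA).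
  + move=> Z Zcl.
    have ZclA : {in A :\ x, forall y, y \in Z -> hd y \in Z}.
      move=> y yA; have := Zcl y; case: eqP => [yw|_]; last first.
        by apply; move: yA; rewrite !inE => /andP[-> ->]; rewrite orbT.
      by move: yA wA; rewrite yw !inE => /andP[_ ->].
    move=> y; rewrite inE => /orP[|yA]; last exact: RR yA.
    rewrite inE => /eqP-> wZ; apply: RR vA _ => //.
    by have := Zcl w; rewrite eqxx; apply; rewrite // !inE wx eqxx.
- by move=> y /AE/orP[/eqP->|/andP[/negPf-> yA]]; rewrite ?eqxx ?LA.
Qed.

(** * Orientation of a connected graph with one cycle *)

Definition tree_branches (G : semiGraph) (x : vertex G)
    (par : vertex G -> branch G) : {set branch G} :=
  par @: [set~ x] :|: [set star (par v) | v in [set~ x]].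

Lemma tree_branches_star (G : semiGraph) (x : vertex G) par (b : branch G) :
  (star b \in tree_branches x par) = (b \in tree_branches x par).
Proof.
suff D c : c \in tree_branches x par -> star c \in tree_branches x par.
  by apply/idP/idP => /D; rewrite ?starK.
rewrite !inE => /orP[] /imsetP[v vx ->]; apply/orP.
  by right; apply/imsetP; exists v.
by left; apply/imsetP; exists v; rewrite ?starK.
Qed.

Section Tree.
Variables (G : semiGraph) (x : vertex G).
Variables (par : vertex G -> branch G) (hd : vertex G -> vertex G).
Hypothesis R : rooted x [set: vertex G] par hd.

Lemma card_tree_branches : #|tree_branches x par| = 2 * #|vertex G|.-1.
Proof.
have inj : {in [set~ x] &, injective par}.
  move=> u v ux vx E; have := rooted_par R (v := u).
  rewrite E (rooted_par R) -?setTD //; last by rewrite setTD.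
  by rewrite setTD => /(_ ux)[].
rewrite cardsU disjoint_setI0 ?cards0 ?subn0; last first.
  apply/pred0P=> b /=; apply/negP=> /andP[/imsetP[u ux ->] /imsetP[v vx E]].
  by have := rooted_star R; rewrite setTD => /(_ v u vx ux); rewrite E eqxx.
rewrite [X in _ + X]card_in_imset ?card_in_imset ?cardsC1 ?mul2n ?addnn //.
by move=> u v ux vx /(inv_inj (@starK G)); exact: inj.
Qed.

(** If no tree edge crossed the border of [A], then [A] and its complement would
both be stable under taking parents, and both would contain the root. *)
Lemma tree_cut : cut_connected (tree_branches x par).
Proof.
have escape (Z : {set vertex G}) y : y \in Z -> x \notin Z ->
    exists v, [/\ v \in [set~ x], v \in Z & hd v \notin Z].
  move=> yZ xZ.
  suff /existsP[v /and3P[? ? ?]] :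
      [exists v, [&& v \in [set~ x], v \in Z & hd v \notin Z]] by exists v.
  apply: contraNT xZ => /existsPn H.
  apply: (rooted_reach R (Z := Z)) (in_setT y) yZ => v; rewrite setTD => vx vZ.
  by have := H v; rewrite vx vZ /= negbK.
have zP v : v \in [set~ x] -> zeta G (par v) = Some v.
  by rewrite -setTD => /(rooted_par R).
have zH v : v \in [set~ x] -> zeta G (star (par v)) = Some (hd v).
  by rewrite -setTD => /(rooted_head R).
move=> A /set0Pn[y yA] AT.
have [xA|xA] := boolP (x \in A); last first.
  have [v [vx vA hA]] := escape A y yA xA.
  exists (star (par v)), (hd v), v; rewrite starK zP // zH //; split=> //.
  by rewrite tree_branches_star inE imset_f.
have /subsetPn[z _ zA] : ~~ ([set: vertex G] \subset A) by rewrite subTset.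
have [||v [vx vA hA]] := escape (~: A) z; rewrite ?inE ?xA //.
exists (par v), v, (hd v); rewrite zP // zH // inE imset_f //.
by split=> //; move: vA hA; rewrite !inE ?negbK.
Qed.

End Tree.

(** This presents the graph of edges without open branch as the graph of the
self-map [hd]. The field [out_reach] contains connectedness and, at once, that
[x] lies on the only cycle. *)
Record unicyclic (G : semiGraph) (x : vertex G)
    (out : vertex G -> branch G) (hd : vertex G -> vertex G) : Prop := Unicyclic {
  out_at : forall v, zeta G (out v) = Some v;
  out_head : forall v, zeta G (star (out v)) = Some (hd v);
  out_star : forall u v, star (out u) != out v;
  out_cover : forall b u v, zeta G b = Some u -> zeta G (star b) = Some v ->
    b = out u \/ star b = out v;
  out_reach : forall (Z : {set vertex G}) v,
    (forall u, u \in Z -> hd u \in Z) -> v \in Z -> x \in Z }.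

(** The root has to be an end of the edge outside the spanning tree, and this edge
is known only after a tree has been chosen. So a second tree, rooted at an end of
that edge, is built inside the first one; having as many edges, it is the same
tree, oriented towards the new root. *)
Lemma unicyclic_orientation (G : semiGraph) :
  0 < #|vertex G| -> cut_connected (closed_branches G) ->
  #|closed_branches G| = 2 * #|vertex G| ->
  exists x out hd, @unicyclic G x out hd.
Proof.
move=> V0 cutL cL; have /card_gt0P[z _] := V0.
have /card_gt0P[d _] : 0 < #|closed_branches G| by rewrite cL; lia.
have closed_star b : b \in closed_branches G -> star b \in closed_branches G.
  by rewrite !inE starK andbC.
have [par [hd [R parL]]] := spanning_tree d z cutL.
have DL : tree_branches z par \subset closed_branches G.
  apply/subsetP=> b; rewrite inE => /orP[] /imsetP[v vz ->].
    exact: parL.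
  by apply: closed_star; exact: parL.
have [c cL' cD] : exists2 c, c \in closed_branches G & c \notin tree_branches z par.
  by apply/subsetPn; apply/negP=> /subset_leq_card; rewrite cL (card_tree_branches R); lia.
have scD : star c \notin tree_branches z par by rewrite tree_branches_star.
move: (cL'); rewrite inE; case zc: (zeta G c) => [x|] //.
case zsc: (zeta G (star c)) => [y|] // _.
have [par' [hd' [R' parD]]] := spanning_tree d x (tree_cut R).
have D'D : tree_branches x par' = tree_branches z par.
  apply/eqP; rewrite eqEcard (card_tree_branches R) (card_tree_branches R') leqnn andbT.
  apply/subsetP=> b; rewrite {1}/tree_branches in_setU => /orP[] /imsetP[v vz ->].
    exact: parD.
  by rewrite tree_branches_star; exact: parD.
have DLc : closed_branches G = [set c; star c] :|: tree_branches x par'.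
  apply/esym/eqP; rewrite eqEcard cardsU cL (card_tree_branches R').
  rewrite disjoint_setI0 ?cards0; last first.
    rewrite D'D; apply/pred0P=> b /=; apply/negP=> /andP[bc bD].
    move: bc; rewrite !inE => /orP[]/eqP E.
      by move: cD; rewrite -E bD.
    by move: scD; rewrite -E bD.
  rewrite cards2 eq_sym star_neq subUset D'D DL subUset !sub1set cL' closed_star //=.
  lia.
have zP v : v \in [set~ x] -> zeta G (par' v) = Some v.
  by rewrite -setTD => /(rooted_par R').
have zH v : v \in [set~ x] -> zeta G (star (par' v)) = Some (hd' v).
  by rewrite -setTD => /(rooted_head R').
have nx v : v <> x -> v \in [set~ x] by move/eqP; rewrite !inE.
exists x, (fun v => if v == x then c else par' v), (fun v => if v == x then y else hd' v).
split.
- by move=> v /=; case: eqP => [->|/nx/zP].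
- by move=> v /=; case: eqP => [_|/nx/zH].
- have pD v : v \in [set~ x] -> par' v \in tree_branches z par.
    by move=> vx; rewrite -D'D in_setU imset_f.
  move=> u v /=; case: (u =P x) => [_|/nx ux]; case: (v =P x) => [_|/nx vx].
  + exact: star_neq.
  + by apply: contraNneq scD => ->; exact: pD.
  + by apply: contraNneq cD => <-; rewrite tree_branches_star; exact: pD.
  + by apply: (rooted_star R'); rewrite setTD.
- move=> b u v zb zsb.
  have : b \in closed_branches G by rewrite inE zb zsb.
  rewrite DLc !inE => /orP[/orP[]/eqP E|/orP[]/imsetP[w wx E]].
  + by left; move: zb; rewrite E zc => -[<-]; rewrite eqxx.
  + by right; move: zsb; rewrite E starK zc => -[<-]; rewrite eqxx.
  + left; move: zb; rewrite E zP // => -[<-].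
    by move: wx; rewrite !inE => /negPf->.
  + right; move: zsb; rewrite E starK zP // => -[<-].
    by move: wx; rewrite !inE => /negPf->.
- move=> Z v Zcl vZ; apply: (rooted_reach R' (Z := Z)) (in_setT v) vZ => w.
  by rewrite setTD !inE => /negPf wx /Zcl; rewrite wx.
Qed.

Lemma star_open_notin (G : semiGraph) (b : branch G) :
  (forall e, e \in edges G -> ~~ (e \subset Bopen G)) ->
  b \in Bopen G -> star b \notin Bopen G.
Proof.
by move=> noopen bO; have [_ /noopen] := starP b; rewrite subUset !sub1set bO.
Qed.

Lemma card_closed_branches (G : semiGraph) :
  (forall e, e \in edges G -> ~~ (e \subset Bopen G)) ->
  #|closed_branches G| + 2 * #|Bopen G| = #|branch G|.
Proof.
move=> noopen.
have E : [set: branch G] = closed_branches G :|: (Bopen G :|: @star G @: Bopen G).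
  apply/setP=> b; rewrite !inE; have -> : (b \in @star G @: Bopen G) = (star b \in Bopen G).
    apply/imsetP/idP => [[c cO ->]|sO]; first by rewrite starK.
    by exists (star b); rewrite ?starK.
  by rewrite inE; do 2 case: (zeta G _ == None).
rewrite -cardsT E cardsU disjoint_setI0 ?cards0 ?subn0; last first.
  apply/pred0P=> b /=; apply/negP=> /andP[bL]; rewrite inE => /orP[bO|/imsetP[c cO E']].
    by move: bL bO; rewrite !inE => /andP[/negPf->].
  by move: bL cO; rewrite !inE E' starK => /andP[_ /negPf->].
rewrite [in RHS]cardsU disjoint_setI0 ?cards0 ?subn0; last first.
  apply/pred0P=> b /=; apply/negP=> /andP[bO /imsetP[c cO E']].
  have := star_open_notin noopen cO.
  by rewrite -E' bO.
by rewrite card_imset ?mul2n ?addnn //; exact: inv_inj (@starK G).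
Qed.

(** * The cycle and the sums around a vertex *)

Section Cycle.
Variables (G : semiGraph) (x : vertex G).
Variables (out : vertex G -> branch G) (hd : vertex G -> vertex G).
Hypothesis U : unicyclic x out hd.

Definition cycle_vertices : {set vertex G} := [set y | fconnect hd x y].

Lemma cycle_root : x \in cycle_vertices.
Proof. by rewrite inE connect0. Qed.

Lemma cycle_head v : v \in cycle_vertices -> hd v \in cycle_vertices.
Proof. by rewrite !inE => /connect_trans; apply; exact: fconnect1. Qed.

Lemma cycle_sub (Z : {set vertex G}) :
  x \in Z -> (forall v, v \in cycle_vertices -> v \in Z -> hd v \in Z) ->
  cycle_vertices \subset Z.
Proof.
move=> xZ Zcl; apply/subsetP=> v; rewrite inE => /iter_findex <-.
elim: (findex _ _ _) => //= n; apply: Zcl.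
by rewrite inE fconnect_iter.
Qed.

(** The image of the orbit is nonempty and stable under [hd], so it contains [x],
and then all of the orbit. *)
Lemma cycle_image : hd @: cycle_vertices = cycle_vertices.
Proof.
have sub : hd @: cycle_vertices \subset cycle_vertices.
  by apply/subsetP=> _ /imsetP[v vC ->]; exact: cycle_head.
apply/eqP; rewrite eqEsubset sub; apply: cycle_sub => [|v vC _]; last exact: imset_f.
apply: (out_reach U) (imset_f hd cycle_root) => u /(subsetP sub) uC.
exact: imset_f.
Qed.

Lemma cycle_inj : {in cycle_vertices &, injective hd}.
Proof. by apply/imset_injP; rewrite cycle_image. Qed.

Lemma branch_cases b :
  [\/ zeta G b = None, zeta G (star b) = None,
      exists u, b = out u | exists u, b = star (out u)].
Proof.
case zb: (zeta G b) => [u|]; last by constructor 1.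
case zsb: (zeta G (star b)) => [v|]; last by constructor 2.
have [bE|sbE] := out_cover U zb zsb; first by constructor 3; exists u.
by constructor 4; exists v; rewrite -sbE starK.
Qed.

Lemma incoming_cases v b : zeta G b = Some v -> b != out v ->
  zeta G (star b) = None \/ exists2 u, b = star (out u) & hd u = v.
Proof.
move=> zb bN; case: (branch_cases b) => [zN|->|[u E]|[u E]]; first by rewrite zN in zb.
- by left.
- by move: zb bN; rewrite E (out_at U) => -[->]; rewrite eqxx.
- by right; exists u => //; move: zb; rewrite E (out_head U) => -[].
Qed.

Hypothesis reg : regular3 G.

Lemma sum_around_two_ones (h : branch G -> nat) v :
  (forall b, b \in Bv v -> b != out v -> h b = 1) ->
  \sum_(b in Bv v) h b = h (out v) + 2.
Proof.
move=> h1; have oB : out v \in Bv v by rewrite inE (out_at U).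
rewrite (big_setD1 (out v)) //=; congr (_ + _).
transitivity (\sum_(b in Bv v :\ out v) 1).
  by apply: eq_bigr => b; rewrite in_setD1 => /andP[bN bB]; exact: h1.
by have := reg v; rewrite sum1_card (cardsD1 (out v)) oB add1n => -[].
Qed.

Lemma sum_around_one_one (h : branch G -> nat) u :
  (forall b, b \in Bv (hd u) -> b != out (hd u) -> b != star (out u) -> h b = 1) ->
  \sum_(b in Bv (hd u)) h b = h (out (hd u)) + h (star (out u)) + 1.
Proof.
set v := hd u => h1; have oB : out v \in Bv v by rewrite inE (out_at U).
have sB : star (out u) \in Bv v :\ out v by rewrite !inE (out_star U) (out_head U) /=.
rewrite (big_setD1 (out v)) //= (big_setD1 (star (out u))) //= addnA; congr (_ + _).
transitivity (\sum_(b in Bv v :\ out v :\ star (out u)) 1).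
  by apply: eq_bigr => b; rewrite !inE => /and3P[bN bN' bB]; apply: h1; rewrite ?inE.
have := reg v; rewrite sum1_card (cardsD1 (out v)) oB.
by rewrite (cardsD1 (star (out u)) (_ :\ _)) sB !add1n => -[].
Qed.

End Cycle.

(** * Counting the numberings *)

Section Count.
Variables (p r : nat) (G : markedSemiGraph r) (x : vertex G).
Variables (out : vertex G -> branch G) (hd : vertex G -> vertex G).
Hypotheses (U : unicyclic x out hd) (reg : regular3 G) (p1 : 1 < p).
Hypothesis no_open : forall b, b \in Bopen G -> star b \notin Bopen G.

Let C := cycle_vertices x hd.

Section Determined.
Variable m : {ffun branch G -> 'I_p}.
Hypothesis mBr : m \in BrSt p G.
Hypothesis m_open : forall b, zeta G b = None -> m b = p - 1 :> nat.

Lemma numbering_star b : m b = p - m (star b) :> nat.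
Proof. by have [_ ms _] := BrStP _ mBr; have := ms b; lia. Qed.

Lemma numbering_open_star b : zeta G (star b) = None -> m b = 1 :> nat.
Proof. by move=> /m_open E; rewrite numbering_star E; lia. Qed.

(** A vertex off the cycle with a wrong value has a predecessor with a wrong
value. So the set of such vertices is contained in its image under [hd], hence
equal to it, hence stable under [hd]; if nonempty it would contain [x]. *)
Lemma numbering_off_cycle v : v \notin C -> m (out v) = p - 1 :> nat.
Proof.
move=> vC; apply/eqP; apply/negPn/negP => vB.
pose Bad := [set v | (v \notin C) && (m (out v) != p - 1 :> nat)].
have BadE : hd @: Bad = Bad.
  apply/esym/eqP; rewrite eqEcard leq_imset_card andbT.
  apply/subsetP=> y; rewrite inE => /andP[yC yB].
  apply/negPn/negP => yN; case/negP: yB; apply/eqP.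
  have [_ _ mv] := BrStP _ mBr.
  have := mv y; rewrite (sum_around_two_ones U reg) => [|b]; first by lia.
  rewrite inE => /eqP zb bN.
  case: (incoming_cases U zb bN) => [/numbering_open_star//|[u E hu]].
  rewrite numbering_star E starK.
  suff -> : m (out u) = p - 1 :> nat by lia.
  apply/eqP; apply: contraNT yN => uB; apply/imsetP; exists u => //.
  by rewrite inE uB andbT; apply: contra yC => uC; rewrite -hu; exact: cycle_head.
have : x \in Bad.
  apply: (out_reach U (v := v)) => [u uB|]; last by rewrite inE vC vB.
  by rewrite -BadE imset_f.
by rewrite inE cycle_root.
Qed.

(** At [hd u] on the cycle, the branch other than [out (hd u)] and [star (out u)]
carries 1, so the values on these two add up to p. *)
Lemma numbering_on_cycle v : v \in C -> m (out v) = m (out x).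
Proof.
suff /subsetP sub : C \subset [set v | m (out v) == m (out x)].
  by move=> /sub; rewrite inE => /eqP.
apply: cycle_sub => [|u uC]; rewrite !inE // => /eqP <-.
have [_ _ mv] := BrStP _ mBr.
apply/eqP/val_inj => /=.
have := mv (hd u); rewrite (sum_around_one_one U reg (u := u)) => [|b].
  have := numbering_star (star (out u)); rewrite starK.
  by have := ltn_ord (m (out u)); lia.
rewrite inE => /eqP zb bN bN'.
case: (incoming_cases U zb bN) => [/numbering_open_star//|[w E hw]].
rewrite numbering_star E starK numbering_off_cycle; first by lia.
apply: contra bN' => wC; rewrite E; apply/eqP; congr (star (out _)).
exact: (cycle_inj U).
Qed.

End Determined.

Lemma numbering_inj (m1 m2 : {ffun branch G -> 'I_p}) :
  m1 \in BrSt p G -> m2 \in BrSt p G ->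
  (forall b, zeta G b = None -> m1 b = p - 1 :> nat) ->
  (forall b, zeta G b = None -> m2 b = p - 1 :> nat) ->
  m1 (out x) = m2 (out x) -> m1 = m2.
Proof.
move=> B1 B2 o1 o2 E.
have Eout u : m1 (out u) = m2 (out u).
  have [uC|uC] := boolP (u \in C); first by rewrite !numbering_on_cycle.
  by apply: val_inj => /=; rewrite !numbering_off_cycle.
apply/ffunP=> b; apply: val_inj => /=.
case: (branch_cases U b) => [zb|zb|[u ->]|[u ->]].
- by rewrite o1 // o2.
- by rewrite !numbering_open_star.
- by rewrite Eout.
- by rewrite (numbering_star B1) (numbering_star B2) starK Eout.
Qed.

Section Built.
Variable a : 'I_p.
Hypothesis a0 : 0 < a.

(** The numbering with value [a] all along the cycle; elsewhere the values are
those that [open_value] and [numbering_off_cycle] force. *)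
Definition out_value v : nat := if v \in C then nat_of_ord a else p - 1.

Definition built_value b : nat :=
  if zeta G b is Some v then
    if b == out v then out_value v
    else if zeta G (star b) is Some u then p - out_value u else 1
  else p - 1.

Lemma out_value_bounds v : 0 < out_value v < p.
Proof. by rewrite /out_value; case: ifP => _; have := ltn_ord a; lia. Qed.

Lemma built_open b : zeta G b = None -> built_value b = p - 1.
Proof. by rewrite /built_value => ->. Qed.

Lemma built_open_star b : zeta G (star b) = None -> built_value b = 1.
Proof.
move=> zsb; rewrite /built_value zsb.
case zb: (zeta G b) => [v|].
  by case: eqP => // E; move: zsb; rewrite E (out_head U).
have := @no_open b; rewrite !inE zb zsb eqxx => /(_ isT).
by [].
Qed.

Lemma built_out u : built_value (out u) = out_value u.
Proof. by rewrite /built_value (out_at U) eqxx. Qed.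

Lemma built_star_out u : built_value (star (out u)) = p - out_value u.
Proof.
by rewrite /built_value (out_head U) (negPf (out_star U _ _)) starK (out_at U).
Qed.

Lemma built_bounds b : 0 < built_value b < p.
Proof.
case: (branch_cases U b) => [zb|zb|[u ->]|[u ->]].
- by rewrite built_open //; lia.
- by rewrite built_open_star //; lia.
- by rewrite built_out out_value_bounds.
- by rewrite built_star_out; have := out_value_bounds u; lia.
Qed.

Lemma built_lt b : built_value b < p.
Proof. by case/andP: (built_bounds b). Qed.

Lemma built_star b : built_value b + built_value (star b) = p.
Proof.
case: (branch_cases U b) => [zb|zb|[u ->]|[u ->]]; rewrite ?starK.
- by rewrite built_open // built_open_star ?starK //; lia.
- by rewrite built_open_star // built_open //; lia.
- by rewrite built_out built_star_out; have := out_value_bounds u; lia.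
- by rewrite built_out built_star_out; have := out_value_bounds u; lia.
Qed.

Lemma built_sum v : \sum_(b in Bv v) built_value b = p + 1.
Proof.
have [vC|vC] := boolP (v \in C).
  move: (vC); rewrite /C -(cycle_image U) => /imsetP[u uC E]; rewrite E.
  rewrite (sum_around_one_one U reg (u := u)) => [|b].
    rewrite built_out built_star_out /out_value -E vC uC.
    by have := ltn_ord a; lia.
  rewrite inE => /eqP zb bN bN'.
  case: (incoming_cases U zb bN) => [/built_open_star//|[w Eb hw]].
  rewrite Eb built_star_out /out_value ifN; first by lia.
  apply: contra bN' => wC; rewrite Eb; apply/eqP; congr (star (out _)).
  exact: (cycle_inj U).
rewrite (sum_around_two_ones U reg) => [|b].
  by rewrite built_out /out_value (negPf vC); lia.
rewrite inE => /eqP zb bN.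
case: (incoming_cases U zb bN) => [/built_open_star//|[u Eb hu]].
rewrite Eb built_star_out /out_value ifN; first by lia.
by apply: contra vC => uC; rewrite -hu; exact: cycle_head.
Qed.

Definition built_numbering : {ffun branch G -> 'I_p} :=
  [ffun b => Ordinal (built_lt b)].

Lemma built_numbering_BrSt : built_numbering \in BrSt p G.
Proof.
apply/BrStP; split=> [b|b|v].
- by rewrite ffunE /=; case/andP: (built_bounds b).
- by rewrite !ffunE /= built_star.
- by rewrite -[RHS](built_sum v); apply: eq_bigr => b _; rewrite ffunE.
Qed.

Lemma built_numbering_root : built_numbering (out x) = a.
Proof.
by apply: val_inj; rewrite ffunE /= built_out /out_value /C cycle_root.
Qed.

End Built.

Lemma card_BrSt :
  (forall m, m \in BrSt p G -> forall b, zeta G b = None -> m b = p - 1 :> nat) ->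
  #|BrSt p G| = p - 1.
Proof.
move=> m_open.
have inj : {in BrSt p G &, injective (fun m : {ffun branch G -> 'I_p} => m (out x))}.
  by move=> m1 m2 B1 B2 E; apply: numbering_inj => //; exact: m_open.
rewrite -(card_in_imset inj).
have -> : [set m (out x) | m : {ffun branch G -> 'I_p} in BrSt p G]
          = [set~ Ordinal (ltnW p1)].
  apply/setP=> a; rewrite !inE -val_eqE /= -lt0n; apply/imsetP/idP => [[m mB ->]|a0].
    by have [m0 _ _] := BrStP _ mB.
  by exists (built_numbering a0); rewrite ?built_numbering_BrSt ?built_numbering_root.
by rewrite cardsC1 card_ord subn1.
Qed.

End Count.

(** * Genus bound and count *)

Theorem proposition2p5p1 (p : nat) (p_prime : prime p) (p_gt2 : 2 < p)
    (g r : nat) (hyp_gr : (0 < 2 * g%:Z - 2 + r%:Z)%R)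
    (G : markedSemiGraph r) (G_connected : connected G) (G_regular : regular3 G)
    (G_type : of_type G g r) :
  ((exists m, m \in BrSt p G) -> g <= 1) /\
  (g = 1 ->
     bijective (@BrSt_incl p r G (minus_ones p r)) /\
     #|BrSt_exp G (minus_ones p r)| = #|BrSt p G| /\
     #|BrSt p G| = p - 1).
Proof.
split=> [[m mB]|g1]; first exact: genus_le1 p_gt2 G_regular G_type mB.
subst g.
have openE (m : {ffun branch G -> 'I_p}) : m \in BrSt p G ->
    forall b, b \in Bopen G -> m b = p - 1 :> nat.
  by apply: open_value => //; lia.
have E : BrSt_exp G (minus_ones p r) = BrSt p G.
  apply/eqP; rewrite eqEsubset BrSt_exp_sub; apply/subsetP=> m mB.
  rewrite inE mB; apply/forallP=> b; rewrite ffunE /= (openE m mB) ?(valP b) //.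
  by rewrite natrB ?prime_gt0 // pchar_Fp_0 // sub0r.
split.
  have sub' : BrSt p G \subset BrSt_exp G (minus_ones p r) by rewrite E.
  exists (fun m => exist _ (val m) (subsetP sub' _ (valP m))) => m; exact: val_inj.
rewrite E; split=> //.
have cB := card_branch_regular G_regular.
have [Er Eg] := G_type.
have cL := card_closed_branches (proj2 G_connected); rewrite card_branch in cL.
(* For g = 1 there are r vertices, and hyp_gr gives r > 0. *)
have [||x [out [hd U]]] := @unicyclic_orientation G _ (connected_cut G_connected).
- lia.
- lia.
apply: (card_BrSt U G_regular) => [|b|]; first exact: ltnW.
  by apply: star_open_notin; exact: (proj2 G_connected).
by move=> m mB b zb; apply: (openE m mB); rewrite inE zb.
Qed.
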